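(* Let $A=(a_{ij})\in M_n(\mathbb{H})$, $n\ge 2$, and let $\gamma\in[0,1]$. Assume that $$|a_{ii}|>r_i(A)^{\gamma}\,c_i(A)^{1-\gamma},\qquad 1\le i\le n.$$ Then $A$ is invertible.
   Context: $\mathbb{H}$ is the skew field of real quaternions with its usual modulus $|\cdot|$, and $M_n(\mathbb{H})$ is the set of $n\times n$ quaternionic matrices. $A$ is invertible if there exists $B\in M_n(\mathbb{H})$ with $AB=BA=I_n$. $r_i(A):=\sum_{j\ne i}|a_{ij}|$ and $c_i(A):=\sum_{j\neq i}|a_{ji}|$. Convention: $0^0=1$. *)

(* Defs.v *)
From HB Require Import structures.
From mathcomp Require Import all_boot all_order all_algebra.
From mathcomp Require Import ring lra.
From mathcomp Require Import reals exp.

Set Implicit Arguments.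
Unset Strict Implicit.
Unset Printing Implicit Defensive.

Import Order.TTheory GRing.Theory Num.Theory.
Local Open Scope ring_scope.

(* Quat a b c d is a + b i + c j + d k. *)
Record quat (R : realType) : Type :=
  Quat { q_re : R; q_i : R; q_j : R; q_k : R }.

Section QuatRing.
Variable R : realType.
Implicit Types x y z : quat R.

Definition quat_to_tuple x : R * R * R * R := (q_re x, q_i x, q_j x, q_k x).
Definition quat_of_tuple (t : R * R * R * R) : quat R :=
  let: (a, b, c, d) := t in Quat a b c d.

Lemma quat_to_tupleK : cancel quat_to_tuple quat_of_tuple.
Proof. by case. Qed.

HB.instance Definition _ := Choice.copy (quat R) (can_type quat_to_tupleK).

Definition quat_zero : quat R := Quat 0 0 0 0.
Definition quat_one : quat R := Quat 1 0 0 0.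
Definition quat_opp x : quat R :=
  let: Quat a b c d := x in Quat (- a) (- b) (- c) (- d).
Definition quat_add x y : quat R :=
  let: Quat a b c d := x in let: Quat a' b' c' d' := y in
  Quat (a + a') (b + b') (c + c') (d + d').
Definition quat_mul x y : quat R :=
  let: Quat a b c d := x in let: Quat a' b' c' d' := y in
  Quat (a * a' - b * b' - c * c' - d * d')
       (a * b' + b * a' + c * d' - d * c')
       (a * c' - b * d' + c * a' + d * b')
       (a * d' + b * c' - c * b' + d * a').

Lemma quat_addA : associative quat_add.
Proof. by move=> [????] [????] [????]; rewrite /= !addrA. Qed.
Lemma quat_addC : commutative quat_add.
Proof. by move=> [????] [????] /=; congr Quat; rewrite addrC. Qed.
Lemma quat_add0 : left_id quat_zero quat_add.
Proof. by move=> [????]; rewrite /= !add0r. Qed.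
Lemma quat_addN : left_inverse quat_zero quat_opp quat_add.
Proof. by move=> [????]; rewrite /= !addNr. Qed.

HB.instance Definition _ :=
  GRing.isZmodule.Build (quat R) quat_addA quat_addC quat_add0 quat_addN.

Lemma quat_mulA : associative quat_mul.
Proof. by move=> [????] [????] [????] /=; congr Quat; ring. Qed.
Lemma quat_mul1l : left_id quat_one quat_mul.
Proof. by move=> [????] /=; congr Quat; ring. Qed.
Lemma quat_mul1r : right_id quat_one quat_mul.
Proof. by move=> [????] /=; congr Quat; ring. Qed.
Lemma quat_mulDl : left_distributive quat_mul quat_add.
Proof. by move=> [????] [????] [????] /=; congr Quat; ring. Qed.
Lemma quat_mulDr : right_distributive quat_mul quat_add.
Proof. by move=> [????] [????] [????] /=; congr Quat; ring. Qed.
Lemma quat_one_neq0 : quat_one != quat_zero.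
Proof. by apply/eqP => -[] /eqP; rewrite oner_eq0. Qed.

HB.instance Definition _ := GRing.Zmodule_isNzRing.Build (quat R)
  quat_mulA quat_mul1l quat_mul1r quat_mulDl quat_mulDr quat_one_neq0.

Definition quat_conj x : quat R :=
  let: Quat a b c d := x in Quat a (- b) (- c) (- d).

Definition quat_normsq x : R :=
  q_re x ^+ 2 + q_i x ^+ 2 + q_j x ^+ 2 + q_k x ^+ 2.

Definition quat_abs x : R := Num.sqrt (quat_normsq x).

Definition quat_scale (r : R) x : quat R :=
  let: Quat a b c d := x in Quat (r * a) (r * b) (r * c) (r * d).

(* At 0 this is 0, since 0^-1 = 0 in R. *)
Definition quat_inv x : quat R :=
  quat_scale (quat_normsq x)^-1 (quat_conj x).

Lemma quat_normsq_eq0 x : (quat_normsq x == 0) = (x == 0).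
Proof.
case: x => a b c d; rewrite /quat_normsq /=.
rewrite !paddr_eq0 ?addr_ge0 ?sqr_ge0// !sqrf_eq0.
apply/idP/eqP => [/andP[/andP[/andP[/eqP-> /eqP->] /eqP->] /eqP->] //|].
by case=> -> -> -> ->; rewrite eqxx.
Qed.

Lemma quat_mulVx x : x != 0 -> quat_inv x * x = 1.
Proof.
rewrite -quat_normsq_eq0; case: x => a b c d.
rewrite /quat_inv /quat_normsq /= => n0.
by congr Quat; field.
Qed.

Lemma quat_mulxV x : x != 0 -> x * quat_inv x = 1.
Proof.
rewrite -quat_normsq_eq0; case: x => a b c d.
rewrite /quat_inv /quat_normsq /= => n0.
by congr Quat; field.
Qed.

Lemma quat_unitP x y : y * x = 1 /\ x * y = 1 -> x != 0.
Proof.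
by move=> [yx1 _]; apply/eqP => x0; move/eqP: yx1;
  rewrite x0 mulr0 eq_sym oner_eq0.
Qed.

Lemma quat_inv_out x : ~~ (x != 0) -> quat_inv x = x.
Proof.
rewrite negbK => /eqP ->; rewrite /quat_inv /=.
by congr Quat; rewrite ?oppr0 mulr0.
Qed.

HB.instance Definition _ := GRing.NzRing_hasMulInverse.Build (quat R)
  quat_mulVx quat_mulxV quat_unitP quat_inv_out.

End QuatRing.

Definition row_radius (R : realType) (n : nat) (A : 'M[quat R]_n) (i : 'I_n) : R :=
  \sum_(j < n | j != i) quat_abs (A i j).

Definition col_radius (R : realType) (n : nat) (A : 'M[quat R]_n) (i : 'I_n) : R :=
  \sum_(j < n | j != i) quat_abs (A j i).

(* The library's unitmx goes through determinants and so requires commutative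
   coefficients. *)
Definition mx_invertible (R : nzRingType) (n : nat) (A : 'M[R]_n) : Prop :=
  exists B : 'M[R]_n, A *m B = 1%:M /\ B *m A = 1%:M.

(* Main.v *)
Require Import Defs.
From mathcomp Require Import all_boot all_order all_algebra.
From mathcomp Require Import ring.
From mathcomp Require Import reals exp.
From HB Require Import structures.
Import Order.TTheory GRing.Theory Num.Theory.
Local Open Scope ring_scope.

(** A quaternionic matrix is invertible as soon as its right kernel is trivial
    ([mx_invertible_of_ker0]): left multiplication by [A] on column vectors is
    an injective real-linear endomorphism of a real space of dimension [4n],
    hence a bijection, and solving [A x = e_j] for every [j] gives the inverse.

    Suppose now that [A x = 0].  Moving the diagonal term to the other side and
    taking moduli, which are multiplicative and subadditive, leaves a statement
    about the nonnegative reals [u_i = |x_i|]: from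
    [|a_ii| u_i <= \sum_(j != i) |a_ij| u_j] for all [i], and
    [|a_ii| > r_i^gamma c_i^(1 - gamma)], deduce [u = 0]
    ([ostrowski_dominance]).

    If [gamma = 1] this is row dominance, refuted at an index where [u] is
    largest.  If [gamma < 1], put [y_i = u_i^(1 / (1 - gamma))].  Hoelder's
    inequality with exponents [1 / gamma] and [1 / (1 - gamma)] (the identity, if
    [gamma = 0]) turns row [i] into [c_i y_i < \sum_(j != i) |a_ij| y_j] whenever [y_i > 0]
    ([holder_row]).  The row sums [r_i] have disappeared, and summing over [i]
    yields [\sum_i c_i y_i < \sum_i c_i y_i] unless [y = 0]
    ([column_dominance]). *)

(** * The modulus of quaternions *)

Lemma quat_absM (R : realType) (x y : quat R) :
  quat_abs (x * y) = quat_abs x * quat_abs y.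
Proof.
have normsqM : quat_normsq (x * y) = quat_normsq x * quat_normsq y.
  by case: x y => [a b c d] [a' b' c' d']; rewrite /quat_normsq /=; ring.
by rewrite /quat_abs normsqM sqrtrM // /quat_normsq !addr_ge0 ?sqr_ge0.
Qed.

Lemma quat_abs_ge0 (R : realType) (x : quat R) : 0 <= quat_abs x.
Proof. exact: sqrtr_ge0. Qed.

Lemma quat_abs_sqr (R : realType) (x : quat R) :
  quat_abs x ^+ 2 = quat_normsq x.
Proof. by rewrite sqr_sqrtr // /quat_normsq !addr_ge0 ?sqr_ge0. Qed.

Lemma quat_abs_eq0 (R : realType) (x : quat R) : quat_abs x = 0 -> x = 0.
Proof.
move=> x0; apply/eqP; rewrite -quat_normsq_eq0 -quat_abs_sqr x0.
by rewrite expr0n.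
Qed.

Lemma quat_abs0 (R : realType) : quat_abs (0 : quat R) = 0.
Proof.
by apply/eqP; rewrite -sqrf_eq0 quat_abs_sqr quat_normsq_eq0.
Qed.

Lemma quat_absN (R : realType) (x : quat R) : quat_abs (- x) = quat_abs x.
Proof. by case: x => a b c d; rewrite /quat_abs /quat_normsq /= !sqrrN. Qed.

Lemma quat_abs_conj (R : realType) (x : quat R) :
  quat_abs (quat_conj x) = quat_abs x.
Proof. by case: x => a b c d; rewrite /quat_abs /quat_normsq /= !sqrrN. Qed.

Lemma quat_re_le_abs (R : realType) (x : quat R) : q_re x <= quat_abs x.
Proof.
apply: le_trans (ler_norm _) _; rewrite -sqrtr_sqr ler_wsqrtr //.
by rewrite /quat_normsq -!addrA lerDl !addr_ge0 ?sqr_ge0.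
Qed.

(** The Cauchy-Schwarz inequality in dimension four comes for free from
    multiplicativity: the scalar product of [x] and [y] is the real part of
    [quat_conj x * y], whose modulus is [|x| |y|]. *)
Lemma quat_absD (R : realType) (x y : quat R) :
  quat_abs (x + y) <= quat_abs x + quat_abs y.
Proof.
rewrite -(@ler_pXn2r _ 2) ?nnegrE ?addr_ge0 ?quat_abs_ge0 //.
have normsqD : quat_normsq (x + y)
  = quat_normsq x + quat_normsq y + q_re (quat_conj x * y) *+ 2.
  by case: x y => [a b c d] [a' b' c' d']; rewrite /quat_normsq /=; ring.
rewrite sqrrD !quat_abs_sqr normsqD addrAC lerD2r lerD2l lerMn2r /=.
by rewrite -[quat_abs x]quat_abs_conj -quat_absM quat_re_le_abs.
Qed.

Lemma quat_abs_sum (R : realType) (I : finType) (P : pred I) (F : I -> quat R) :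
  quat_abs (\sum_(i | P i) F i) <= \sum_(i | P i) quat_abs (F i).
Proof.
elim/big_ind2: _ => [|x a y b xa yb|//]; first by rewrite quat_abs0.
exact: le_trans (quat_absD _ _ _) (lerD xa yb).
Qed.

(** * Quaternionic matrices as real-linear maps *)

Section RealCoordinates.
Variables (R : realType) (n : nat).

Definition quat_coords (x : 'cV[quat R]_n) : 'M[R]_(n, 4) :=
  \matrix_(i, k)
    [:: q_re (x i 0); q_i (x i 0); q_j (x i 0); q_k (x i 0)]`_k.

Definition quat_of_coords (M : 'M[R]_(n, 4)) : 'cV[quat R]_n :=
  \col_i Quat (M i 0) (M i 1) (M i 2) (M i 3).

Lemma quat_coordsK : cancel quat_coords quat_of_coords.
Proof.
move=> x; apply/matrixP => i j; rewrite !mxE ord1 /=.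
by case: (x i 0).
Qed.

Lemma quat_of_coordsK : cancel quat_of_coords quat_coords.
Proof.
move=> M; apply/matrixP => i k; rewrite !mxE.
by case: k => [[|[|[|[|]]]] //= lt_k4]; congr (M _ _); apply: val_inj.
Qed.

(** Real scalars are made to act on the right, where they commute with left
    multiplication by a quaternionic matrix by mere associativity. *)
Lemma quat_of_coords_linear (a : R) (M N : 'M[R]_(n, 4)) :
  quat_of_coords (a *: M + N)
  = quat_of_coords M *m (Quat a 0 0 0)%:M + quat_of_coords N.
Proof.
apply/matrixP => i j; rewrite !mxE big_ord1 !mxE.
rewrite (ord1 j) eqxx mulr1n /=.
by congr Quat => /=; ring.
Qed.

Lemma quat_coords_linear (a : R) (x y : 'cV[quat R]_n) :
  quat_coords (x *m (Quat a 0 0 0)%:M + y) = a *: quat_coords x + quat_coords y.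
Proof.
by apply: (can_inj quat_of_coordsK); rewrite quat_of_coords_linear !quat_coordsK.
Qed.

Definition quat_coords_mul (A : 'M[quat R]_n) (M : 'M[R]_(n, 4)) : 'M[R]_(n, 4) :=
  quat_coords (A *m quat_of_coords M).

Lemma quat_coords_mul_is_linear A : linear (quat_coords_mul A).
Proof.
move=> a M N; rewrite /quat_coords_mul quat_of_coords_linear mulmxDr mulmxA.
exact: quat_coords_linear.
Qed.

HB.instance Definition _ A :=
  GRing.isLinear.Build _ _ _ _ (quat_coords_mul A) (quat_coords_mul_is_linear A).

Lemma quat_coords0 : quat_coords 0 = 0.
Proof.
apply/matrixP => i k; rewrite !mxE.
by case: k => [[|[|[|[|]]]]].
Qed.

(** Determinants do not make sense over the quaternions, so the rank argument is
    made over the reals, on the matrix of [quat_coords_mul A].  It is used only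
    to solve [A x = b]; that the right inverse [B] is also a left inverse
    follows from injectivity and [A (B A - 1) = 0]. *)
Lemma mx_invertible_of_ker0 (A : 'M[quat R]_n) :
  (forall x : 'cV[quat R]_n, A *m x = 0 -> x = 0) -> mx_invertible A.
Proof.
move=> kerA0.
have unitL : lin_mx (quat_coords_mul A) \in unitmx.
  rewrite -row_free_unit; apply: inj_row_free => v.
  rewrite mul_rV_lin => /(congr1 vec_mx); rewrite mxvecK linear0 => vL0.
  have /kerA0 v0 : A *m quat_of_coords (vec_mx v) = 0.
    by apply: (can_inj quat_coordsK); rewrite quat_coords0.
  apply: (can_inj vec_mxK); apply: (can_inj quat_of_coordsK).
  by rewrite v0 linear0 -quat_coords0 quat_coordsK.
have solve (b : 'cV[quat R]_n) : exists x, A *m x == b.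
  exists (quat_of_coords
    (vec_mx (mxvec (quat_coords b) *m invmx (lin_mx (quat_coords_mul A))))).
  apply/eqP/(can_inj quat_coordsK); rewrite -/(quat_coords_mul A _).
  by rewrite -mx_rV_lin mulmxKV // mxvecK.
pose B := \matrix_(i, j) xchoose (solve (col j 1%:M)) i 0.
have AB : A *m B = 1%:M.
  apply/matrixP => i j.
  have /eqP/matrixP/(_ i 0) := xchooseP (solve (col j 1%:M)).
  rewrite [RHS]mxE => <-; rewrite !mxE.
  by apply: eq_bigr => k _; rewrite mxE.
exists B; split => //.
apply/matrixP => i j.
have /matrixP/(_ i 0) : col j (B *m A) = col j 1%:M.
  apply/eqP; rewrite -subr_eq0; apply/eqP/kerA0.
  by rewrite !colE -mulmxBl mulmxA mulmxBr mulmxA AB mul1mx mulmx1 subrr mul0mx.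
by rewrite !mxE.
Qed.

End RealCoordinates.

(** * Dominance conditions for nonnegative real systems *)

Lemma weighted_amgm (R : realType) (t a b : R) : 0 <= t < 1 -> 0 <= a -> 0 <= b ->
  a `^ (1 - t) * b `^ t <= (1 - t) * a + t * b.
Proof.
move=> /andP[]; rewrite le_eqVlt => /predU1P[<- _ a0 b0|t0 t1 a0 b0].
  by rewrite subr0 powRr1 // powRr0 mulr1 mul1r mul0r addr0.
have s0 : 0 < 1 - t by rewrite subr_gt0.
have := @conjugate_powR R (a `^ (1 - t)) (b `^ t) (1 - t)^-1 t^-1
  (powR_ge0 _ _) (powR_ge0 _ _).
rewrite !invr_gt0 !invrK -!powRrM !mulfV ?gt_eqF // !powRr1 //.
by rewrite [a * _]mulrC [b * _]mulrC; apply => //; rewrite subrK.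
Qed.

(** The row indexed by a maximal [u i] cannot hold unless that maximum is 0. *)
Lemma row_dominance (R : realType) (I : finType) (a : I -> I -> R) (d u : I -> R) :
  (forall i j, 0 <= a i j) -> (forall i, 0 <= u i) ->
  (forall i, d i * u i <= \sum_(j | j != i) a i j * u j) ->
  (forall i, \sum_(j | j != i) a i j < d i) ->
  forall i, u i = 0.
Proof.
move=> a0 u0 du rd i0.
case: (arg_maxP u (erefl true : xpredT i0)) => i _ umax.
have ui : u i <= 0.
  rewrite leNgt; apply/negP => ui.
  have : \sum_(j | j != i) a i j * u j <= (\sum_(j | j != i) a i j) * u i.
    by rewrite mulr_suml ler_sum // => j _; rewrite ler_wpM2l //; exact: umax.
  move=> /(le_trans (du i)); rewrite ler_pM2r // leNgt.
  by rewrite rd.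
apply/eqP; rewrite eq_le u0 andbT.
by apply: le_trans ui; apply: umax.
Qed.

(** Summed over [i], the two sides of the hypothesis are the same double sum
    read by columns and by rows, so no single inequality can be strict. *)
Lemma column_dominance (R : realType) (I : finType) (a : I -> I -> R) (y : I -> R) :
  (forall i, 0 <= y i) ->
  (forall i, y i != 0 ->
    (\sum_(j | j != i) a j i) * y i < \sum_(j | j != i) a i j * y j) ->
  (forall i j, 0 <= a i j) ->
  forall i, y i = 0.
Proof.
move=> y0 cy a0 i; apply/eqP/negPn/negP => yi.
have cyw k : (\sum_(j | j != k) a j k) * y k <= \sum_(j | j != k) a k j * y j.
  have [->|yk] := eqVneq (y k) 0; last exact/ltW/cy.
  by rewrite mulr0 sumr_ge0 // => j _; rewrite mulr_ge0.
have : \sum_k (\sum_(j | j != k) a j k) * y k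
     < \sum_k \sum_(j | j != k) a k j * y j.
  by rewrite (bigD1 i) //= [ltRHS](bigD1 i) //= ltr_leD ?cy ?ler_sum.
under eq_bigr do rewrite mulr_suml.
rewrite (exchange_big_dep predT) //=.
under eq_bigr do under eq_bigl do rewrite eq_sym.
by rewrite ltxx.
Qed.

(** Hoelder's inequality for one row, with the factor [r^t] cancelled.  Writing
    [d = r^t e^(1-t)], which is possible because [r > 0], the hypothesis says
    that [c < e].  Instead of Hoelder's
    inequality itself, its proof is run on the row: the weighted
    arithmetic-geometric inequality
    [y_j^(1-t) s^t <= (1-t) y_j + t s], weighted by [a j] and summed with
    [s = e w / r], gives [e w <= (1-t) \sum_j a_j y_j + t e w], where
    [y_j] and [w] are the powers of [u_j] and [v] with exponent [1/(1-t)]. *)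
Lemma holder_row (R : realType) (I : finType) (P : pred I) (a u : I -> R)
    (c d t v : R) :
  0 <= t < 1 -> (forall j, 0 <= a j) -> (forall j, 0 <= u j) -> 0 <= c -> 0 < v ->
  (\sum_(j | P j) a j) `^ t * c `^ (1 - t) < d ->
  d * v <= \sum_(j | P j) a j * u j ->
  c * v `^ (1 - t)^-1 < \sum_(j | P j) a j * u j `^ (1 - t)^-1.
Proof.
move=> t01 a0 u0 c0 v0; set r := \sum_(j | P j) a j => rcd dv.
have [t0 t1] : 0 <= t /\ 0 < 1 - t by rewrite subr_gt0; case/andP: t01.
have tI : (1 - t) * (1 - t)^-1 = 1 by rewrite mulfV ?gt_eqF.
have d0 : 0 < d by apply: le_lt_trans rcd; rewrite mulr_ge0 ?powR_ge0.
(* A zero row would contradict [0 < d * v <= \sum_j a j * u j]. *)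
have r0 : 0 < r.
  rewrite lt_neqAle sumr_ge0 // andbT; apply/eqP => /esym/eqP.
  rewrite psumr_eq0 // => /allP a_0.
  have : 0 < \sum_(j | P j) a j * u j by apply: lt_le_trans dv; rewrite mulr_gt0.
  rewrite big1 ?ltxx // => j Pj.
  by have /implyP/(_ Pj)/eqP -> := a_0 j (mem_index_enum j); rewrite mul0r.
have rt0 : 0 < r `^ t by rewrite powR_gt0.
pose e := (d / r `^ t) `^ (1 - t)^-1.
have eE : r `^ t * e `^ (1 - t) = d.
  rewrite -powRrM mulrC mulVf ?gt_eqF // powRr1 ?divr_ge0 ?ltW //.
  by rewrite divfK ?gt_eqF.
have e0 : 0 < e by rewrite powR_gt0 // divr_gt0.
pose w := v `^ (1 - t)^-1; pose y j := u j `^ (1 - t)^-1.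
have w0 : 0 < w by rewrite powR_gt0.
have ce : c < e.
  rewrite -[c]powRr1 // -{1}tI powRrM gt0_ltr_powR ?invr_gt0 ?nnegrE //.
  - exact: powR_ge0.
  - by rewrite divr_ge0 ?ltW.
  - by rewrite ltr_pdivlMr // mulrC.
apply: (@lt_le_trans _ _ (e * w)); first by rewrite ltr_pM2r.
(* This choice of [s] makes both the left-hand side [s `^ t * (d * v)] and the
   constant term [r * s] equal to [e * w]. *)
pose s := e * w / r.
have s0 : 0 < s by rewrite divr_gt0 ?mulr_gt0.
have rootK (z : R) : 0 <= z -> (z `^ (1 - t)^-1) `^ (1 - t) = z.
  by move=> z0; rewrite -powRrM mulrC tI powRr1.
have lhs : s `^ t * (d * v) = e * w.
  rewrite -{1}eE -{1}[v]rootK ?ltW // -/w.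
  have -> : s `^ t * (r `^ t * e `^ (1 - t) * w `^ (1 - t))
          = (s * r) `^ t * (e * w) `^ (1 - t).
    rewrite (powRM t (ltW s0) (ltW r0)) (powRM (1 - t) (ltW e0) (ltW w0)).
    by rewrite -!mulrA.
  rewrite divfK ?gt_eqF // -powRD; last by rewrite subrKC oner_eq0.
  by rewrite subrKC powRr1 // ltW // mulr_gt0.
have : e * w <= \sum_(j | P j) a j * ((1 - t) * y j + t * s).
  rewrite -lhs; apply: (@le_trans _ _ (s `^ t * \sum_(j | P j) a j * u j)).
    by rewrite ler_wpM2l ?powR_ge0.
  rewrite mulr_sumr ler_sum // => j _; rewrite mulrCA ler_wpM2l // mulrC.
  rewrite -{1}[u j]rootK //; apply: weighted_amgm => //; last exact: ltW.
  exact: powR_ge0.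
under eq_bigr do rewrite mulrDr mulrCA.
rewrite big_split /= -mulr_sumr -mulr_suml -/r mulrCA.
have -> : r * s = e * w by rewrite mulrC divfK ?gt_eqF.
move=> H; rewrite -(ler_pM2l t1).
by rewrite mulrBl mul1r lerBlDr.
Qed.

(** [t = 1] is apart because there the Hoelder exponent [1 / (1 - t)] is infinite:
    Hoelder's inequality degenerates to a bound by the maximum. *)
Lemma ostrowski_dominance (R : realType) (I : finType) (a : I -> I -> R)
    (d u : I -> R) (t : R) :
  0 <= t <= 1 -> (forall i j, 0 <= a i j) -> (forall i, 0 <= u i) ->
  (forall i, (\sum_(j | j != i) a i j) `^ t * (\sum_(j | j != i) a j i) `^ (1 - t)
     < d i) ->
  (forall i, d i * u i <= \sum_(j | j != i) a i j * u j) ->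
  forall i, u i = 0.
Proof.
move=> /andP[t0]; rewrite le_eqVlt => /predU1P[->|t1] a0 u0 rcd du.
  apply: (@row_dominance _ _ a d) => // i.
  by have := rcd i; rewrite subrr powRr0 mulr1 powRr1 ?sumr_ge0.
move=> i; apply: (@powR_eq0_eq0 _ _ (1 - t)^-1); move: i.
apply: (@column_dominance _ _ a) => // i; first exact: powR_ge0.
rewrite powR_eq0 negb_and negbK => /orP[ui|]; last first.
  by rewrite invr_eq0 subr_eq0 gt_eqF.
apply: (@holder_row _ _ _ _ _ _ (d i)) => //.
- by rewrite t0 t1.
- by rewrite sumr_ge0.
- by rewrite lt_neqAle eq_sym ui u0.
Qed.

Theorem corollary3p5 (R : realType) (n : nat) (A : 'M[quat R]_n) (gamma : R) :
  (2 <= n)%N ->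
  0 <= gamma <= 1 ->
  (forall i : 'I_n,
     row_radius A i `^ gamma * col_radius A i `^ (1 - gamma)
       < quat_abs (A i i)) ->
  mx_invertible A.
Proof.
move=> _ gamma01 dom; apply: mx_invertible_of_ker0 => x Ax0.
suff x0 i : quat_abs (x i 0) = 0.
  by apply/colP => i; rewrite mxE; apply/quat_abs_eq0/x0.
move: i; apply: (@ostrowski_dominance _ _ (fun i j => quat_abs (A i j))
  (fun i => quat_abs (A i i)) _ _ gamma01) => [i j|i|//|i];
  try exact: quat_abs_ge0.
have /matrixP/(_ i 0) := Ax0; rewrite !mxE (bigD1 i) //= => /eqP.
rewrite addr_eq0 -quat_absM => /eqP ->; rewrite quat_absN.
apply: le_trans (quat_abs_sum _ _ _ _) _.
by rewrite ler_sum // => j _; rewrite quat_absM.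
Qed.
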